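(* Let $\Sigma=(X,\mathcal{D},\phi)$ be a forward complete system whose flow is Lipschitz continuous on compact intervals. If $0$ is uniformly globally asymptotically stable (UGAS) for $\Sigma$, then there exists a non-coercive Lyapunov function for $\Sigma$ which is Lipschitz continuous on bounded balls.
   Context: Notation: $\mathbb{R}_+=[0,\infty)$. $\mathcal{K}$ is the set of continuous strictly increasing $\gamma:\mathbb{R}_+\to\mathbb{R}_+$ with $\gamma(0)=0$; $\mathcal{K}_\infty$ is the set of unbounded $\gamma\in\mathcal{K}$; $\mathcal{L}$ is the set of continuous decreasing $\gamma:\mathbb{R}_+\to\mathbb{R}_+$ with $\lim_{t\to\infty}\gamma(t)=0$; $\mathcal{KL}$ is the set of $\beta:\mathbb{R}_+^2\to\mathbb{R}_+$ with $\beta(\cdot,t)\in\mathcal{K}$ for all $t\ge0$ and $\beta(r,\cdot)\in\mathcal{L}$ for all $r>0$. System: A (forward complete dynamical) system $\Sigma=(X,\mathcal{D},\phi)$ consists of a normed linear space $(X,\|\cdot\|_X)$, a set $D$ of disturbance values (a nonempty subset of a normed linear space), a set $\mathcal{D}$ of functions $d:\mathbb{R}_+\to D$, and a map $\phi:\mathbb{R}_+\times X\times\mathcal{D}\to X$ (defined everywhere). $\mathcal{D}$ is shift-invariant ($d\in\mathcal{D}$, $\tau\ge0$ imply $d(\cdot+\tau)\in\mathcal{D}$) and closed under concatenation (for $d_1,d_2\in\mathcal{D}$, $t>0$, the function equal to $d_1(\tau)$ for $\tau\in[0,t]$ and $d_2(\tau-t)$ for $\tau>t$ is in $\mathcal{D}$).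 Moreover: $\phi(0,x,d)=x$ for all $x,d$; causality: if $d(s)=\tilde d(s)$ for all $s\in[0,t]$ then $\phi(t,x,d)=\phi(t,x,\tilde d)$; for each $(x,d)$ the map $t\mapsto\phi(t,x,d)$ is continuous; cocycle property: $\phi(h,\phi(t,x,d),d(t+\cdot))=\phi(t+h,x,d)$ for all $t,h\ge0$, $x\in X$, $d\in\mathcal{D}$. Flow Lipschitz continuous on compact intervals: for all $\tau>0$ and $r>0$ there is $L>0$ such that $\|\phi(t,x,d)-\phi(t,y,d)\|_X\le L\|x-y\|_X$ for all $x,y\in X$ with $\|x\|_X,\|y\|_X\le r$, all $t\in[0,\tau]$ and all $d\in\mathcal{D}$. UGAS: there is $\beta\in\mathcal{KL}$ with $\|\phi(t,x,d)\|_X\le\beta(\|x\|_X,t)$ for all $x\in X$, $d\in\mathcal{D}$, $t\ge0$. Non-coercive Lyapunov function: a continuous $V:X\to\mathbb{R}_+$ with $V(0)=0$ for which there exist $\psi_2\in\mathcal{K}_\infty$ and $\alpha\in\mathcal{K}$ such that $0<V(x)\le\psi_2(\|x\|_X)$ for all $x\in X\setminus\{0\}$, and $\dot V_d(x):=\liminf_{t\to+0}\frac1t\big(V(\phi(t,x,d))-V(x)\big)\le-\alpha(\|x\|_X)$ for all $x\in X$, $d\in\mathcal{D}$. Lipschitz continuous on bounded balls: for every $R>0$ there is $L_R>0$ with $|V(x)-V(y)|\le L_R\|x-y\|_X$ for all $x,y$ with $\|x\|_X,\|y\|_X\le R$. *)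

(* Defs.v *)
From HB Require Import structures.
From mathcomp Require Import all_boot all_order all_algebra.
From mathcomp Require Import all_classical all_reals all_analysis.

Set Implicit Arguments.
Unset Strict Implicit.
Unset Printing Implicit Defensive.

Import Order.TTheory GRing.Theory Num.Theory.
Import numFieldNormedType.Exports.

Local Open Scope classical_set_scope.
Local Open Scope ring_scope.

(* Functions on R_+ = [0, +oo[ are represented by functions on R of which only
   the values at nonnegative arguments are constrained. *)

Section ComparisonFunctions.
Variable R : realType.
Implicit Types (g : R -> R) (b : R -> R -> R).

Definition class_K g : Prop :=
  [/\ {within `[0, +oo[, continuous g},
      {in `[0, +oo[ &, {homo g : x y / x < y}},
      g 0 = 0
    & {in `[0, +oo[, forall x, 0 <= g x}].

Definition class_Kinfty g : Prop :=
  class_K g /\ forall M : R, exists2 r, 0 <= r & M < g r.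

(* "Decreasing" is read in the weak sense. *)
Definition class_L g : Prop :=
  [/\ {within `[0, +oo[, continuous g},
      {in `[0, +oo[ &, {homo g : x y /~ x <= y}},
      g t @[t --> +oo] --> (0 : R)
    & {in `[0, +oo[, forall x, 0 <= g x}].

Definition class_KL b : Prop :=
  (forall t, 0 <= t -> class_K (fun r => b r t)) /\
  (forall r, 0 < r -> class_L (b r)).

End ComparisonFunctions.

Section Disturbances.
Variables (R : realType) (U : Type).
Implicit Type d : R -> U.

Definition time_shift (tau : R) d : R -> U := fun s => d (s + tau).

Definition concat (t : R) d1 d2 : R -> U :=
  fun s => if s <= t then d1 s else d2 (s - t).

End Disturbances.

(* A set of functions R_+ -> D is represented by, for instance, the set of all
   their extensions to R; by causality, the values of a disturbance at negative
   times never influence the flow.  The flow is a total function, constrained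
   only at nonnegative times and at admissible disturbances. *)
Record fc_system (R : realType) (X U : normedModType R) := FCSystem {
  dist_values : set U;
  dists : set (R -> U);
  flow : R -> X -> (R -> U) -> X;
  dist_values_neq0 : dist_values !=set0;
  dists_values : forall d, dists d -> forall t, 0 <= t -> dist_values (d t);
  dists_shift : forall d tau, dists d -> 0 <= tau -> dists (time_shift tau d);
  dists_concat : forall d1 d2 t, dists d1 -> dists d2 -> 0 < t ->
    dists (concat t d1 d2);
  flow0 : forall x d, dists d -> flow 0 x d = x;
  flow_causal : forall t x d d', 0 <= t -> dists d -> dists d' ->
    (forall s, 0 <= s <= t -> d s = d' s) -> flow t x d = flow t x d';
  flow_continuous : forall x d, dists d ->
    {within `[0, +oo[, continuous (fun t => flow t x d)};
  flow_cocycle : forall t h x d, 0 <= t -> 0 <= h -> dists d ->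
    flow h (flow t x d) (time_shift t d) = flow (t + h) x d
}.

Section Stability.
Variables (R : realType) (X U : normedModType R) (S : fc_system X U).

Definition flow_lipschitz_on_compact_intervals : Prop :=
  forall tau r : R, 0 < tau -> 0 < r ->
    exists2 L : R, 0 < L &
      forall (x y : X) (t : R) (d : R -> U),
        `|x| <= r -> `|y| <= r -> 0 <= t <= tau -> dists S d ->
        `|flow S t x d - flow S t y d| <= L * `|x - y|.

Definition UGAS : Prop :=
  exists2 b : R -> R -> R, class_KL b &
    forall (x : X) (d : R -> U) (t : R), dists S d -> 0 <= t ->
      `|flow S t x d| <= b `|x| t.

(* The lower right Dini derivative is extended-real valued: it may be
   infinite. *)
Definition dini_derivative (V : X -> R) (d : R -> U) (x : X) : \bar R :=
  limf_einf (fun t : R => (t^-1 * (V (flow S t x d) - V x))%:E) (0 : R)^'+.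

Definition noncoercive_lyapunov (V : X -> R) : Prop :=
  [/\ continuous V, (forall x, 0 <= V x), V 0 = 0 &
    exists psi2 alpha : R -> R,
      [/\ class_Kinfty psi2, class_K alpha,
          (forall x, x != 0 -> 0 < V x <= psi2 `|x|)
        & (forall x d, dists S d ->
            (dini_derivative V d x <= (- alpha `|x|)%:E)%E)]].

End Stability.

Definition lipschitz_on_bounded_balls (R : realType) (X : normedModType R)
    (V : X -> R) : Prop :=
  forall r : R, 0 < r ->
    exists2 L : R, 0 < L &
      forall x y : X, `|x| <= r -> `|y| <= r -> `|V x - V y| <= L * `|x - y|.

(* Main.v *)
Require Import Defs.
From mathcomp Require Import all_boot all_order all_algebra.
From mathcomp Require Import all_classical all_reals all_analysis.
From mathcomp Require Import ring lra.

Set Implicit Arguments.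
Unset Strict Implicit.
Unset Printing Implicit Defensive.

Import Order.TTheory GRing.Theory Num.Theory.
Import numFieldNormedType.Exports.

Local Open Scope classical_set_scope.
Local Open Scope ring_scope.

(** The Lyapunov function is an explicit supremum along trajectories.  Write
    (s - c)^+ for the positive part of s - c, and put
      V(x) = sup over k, t >= 0 and admissible d of
             a_k e^(2t) (|phi(t, x, d)| - 1/(k+1))^+,
    with positive weights a_k chosen below.

    Decay.  Running a disturbance d for time h and then any d' is running the
    concatenation of the two, so every term of V(phi(h, x, d)), multiplied by
    e^(2h), is a term of V(x).  Hence e^(2h) V(phi(h, x, d)) <= V(x), and the
    lower Dini derivative of V is at most -V(x).  The terms with t = 0 give
    V(x) >= alpha(|x|) with alpha(r) = sup_k a_k (r - 1/(k+1))^+, a function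
    of class K; so V decreases at rate at least alpha.

    Finiteness and regularity.  On the ball of radius n+1, UGAS supplies a time
    T_n after which every trajectory has norm at most 1/(n+1); from then on the
    terms with k <= n vanish.  Before T_n the flow is Lipschitz uniformly in
    time and disturbance, so the terms with k <= n, taken without their weight,
    share a Lipschitz constant C_n on that ball (lemma weighted_excess_lip).
    With a_k = 1 / (1 + C_k), the terms with k > n have constant
    a_k C_k <= 1 there, and all terms together have constant 1 + C_n (lemma
    exists_weights).  A supremum of functions vanishing at 0 that share a
    Lipschitz constant on each ball is finite and has the same constants.

    Both comparison functions are countable suprema of wedges
    p_i (s - c_i)^+, to which the same argument on suprema applies: alpha, and
    an upper bound psi_2 of class K_infty built from the Lipschitz constants
    of V. *)

(** * Suprema of uniformly Lipschitz families *)

Lemma lipschitz_balls_continuous (R : realType) (X : normedModType R)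
    (V : X -> R) :
  lipschitz_on_bounded_balls V -> continuous V.
Proof.
move=> lipV x; have x1 : 0 < `|x| + 1 by rewrite ltr_wpDl.
have [L L0 HL] := lipV _ x1.
apply/cvgrPdist_lt => e e0.
have m0 : 0 < Num.min 1 (e / L) by rewrite lt_min ltr01 divr_gt0.
near=> y.
have : `|x - y| < Num.min 1 (e / L).
  by near: y; exact: cvgr_dist_lt.
rewrite lt_min ltr_pdivlMr// => /andP[xy1 xye].
apply: le_lt_trans (HL x y _ _) _; rewrite 1?mulrC//; first by rewrite lerDl.
have := lerB_dist y x; rewrite distrC; lra.
Unshelve. all: by end_near. Qed.

Section SupOver.
Variables (R : realType) (X : normedModType R) (I : Type) (A : set I).
Variable f : I -> X -> R.

Definition unif_lipschitz : Prop :=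
  forall r : R, 0 < r -> exists2 L : R, 0 < L &
    forall i x y, A i -> `|x| <= r -> `|y| <= r ->
      `|f i x - f i y| <= L * `|x - y|.

Definition sup_over (x : X) : R := sup [set f i x | i in A].

Lemma sup_over_le x M : A !=set0 -> (forall i, A i -> f i x <= M) ->
  sup_over x <= M.
Proof.
move=> [i Ai] fM; apply: ge_sup; first by exists (f i x), i.
by move=> _ [j Aj <-]; exact: fM.
Qed.

Hypothesis f_at0 : forall i, A i -> f i 0 = 0.
Hypothesis f_lip : unif_lipschitz.

(** The hypotheses serve to bound the family at x: on a ball containing x, its
    members stay below the common Lipschitz constant times the norm of x. *)
Lemma le_sup_over i x : A i -> f i x <= sup_over x.
Proof.
move=> Ai; apply: ub_le_sup; last by exists i.
have x1 : 0 < `|x| + 1 by rewrite ltr_wpDl.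
have [L L0 HL] := f_lip x1.
exists (L * `|x|) => _ [j Aj <-].
have := HL j x 0 Aj; rewrite f_at0// !subr0 normr0 lerDl ler01 ltW//.
by move=> /(_ isT isT); exact/le_trans/ler_norm.
Qed.

Lemma sup_over_lipschitz : A !=set0 -> lipschitz_on_bounded_balls sup_over.
Proof.
move=> A0 r r0; have [L L0 HL] := f_lip r0; exists L => // x y xr yr.
have half u v : `|u| <= r -> `|v| <= r ->
    sup_over u <= sup_over v + L * `|u - v|.
  move=> ur vr; apply: sup_over_le => // i Ai.
  apply: le_trans (lerD (le_sup_over v Ai) (lexx _)).
  by rewrite -lerBlDl; apply: le_trans (ler_norm _) (HL _ _ _ Ai ur vr).
by rewrite ler_norml; have := half x y xr yr; have := half y x yr xr;
  rewrite (distrC y); lra.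
Qed.

Lemma sup_over0 : A !=set0 -> sup_over 0 = 0.
Proof.
move=> A0; apply/le_anti/andP; split.
  by apply: sup_over_le => // i Ai; rewrite f_at0.
by case: A0 => i Ai; rewrite -(f_at0 Ai) le_sup_over.
Qed.

End SupOver.

(** * Comparison functions as suprema of wedges *)

Section Excess.
Variable R : realType.
Implicit Types c s u : R.

Definition excess c s : R := Num.max (s - c) 0.

Lemma excess_ge0 c s : 0 <= excess c s.
Proof. by rewrite le_max lexx orbT. Qed.

Lemma le_excess c s : s - c <= excess c s.
Proof. by rewrite le_max lexx. Qed.

Lemma excess_eq0 c s : s <= c -> excess c s = 0.
Proof. by move=> sc; apply/max_idPr; rewrite subr_le0. Qed.

Lemma excess_lip c s u : `|excess c s - excess c u| <= `|s - u|.
Proof.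
rewrite /excess; have [?|?] := leP (s - c) 0; have [?|?] := leP (u - c) 0;
  rewrite ler_norml; have := ler_norm (s - u); have := ler_norm (u - s);
  rewrite (distrC u); lra.
Qed.

(** As s grows, (s - c)^+ / s does not decrease; stated without division. *)
Lemma excess_star c s u : 0 <= c -> 0 <= s <= u ->
  u * excess c s <= s * excess c u.
Proof.
move=> c0 /andP[s0 su]; have u0 := le_trans s0 su.
rewrite /excess; have [?|?] := leP (s - c) 0.
  by rewrite mulr0 mulr_ge0// le_max lexx orbT.
apply: (@le_trans _ _ (s * (u - c))); first by nra.
by rewrite ler_wpM2l// le_max lexx.
Qed.

End Excess.

Section SupWedges.
Variables (R : realType) (p c : nat -> R).

(** The argument lives in R^o, the real line as a normed space over itself, so
    that the lemmas on suprema of families apply. *)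
Definition wedge (i : nat) (s : R^o) : R := p i * excess (c i) s.

Definition sup_wedges (s : R) : R := sup_over setT wedge s.

Hypothesis p_gt0 : forall i, 0 < p i.
Hypothesis c_ge0 : forall i, 0 <= c i.
Hypothesis c_small : forall s, 0 < s -> exists i, c i < s.
Hypothesis p_bound : forall r, exists2 L : R,
  0 < L & forall i, c i < r -> p i <= L.

Let N0 : [set: nat] !=set0. Proof. by exists 0%N. Qed.

Lemma wedge0 i : [set: nat] i -> wedge i 0 = 0.
Proof. by rewrite /wedge excess_eq0 ?mulr0. Qed.

Lemma wedge_lip : unif_lipschitz setT wedge.
Proof.
move=> r r0; have [L L0 HL] := p_bound r; exists L => // i x y _ xr yr.
rewrite /wedge -mulrBr normrM (gtr0_norm (p_gt0 i)).
have [cr|rc] := ltP (c i) r.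
  by rewrite ler_pM ?excess_lip ?HL// ltW.
have flat z : `|z| <= r -> excess (c i) z = 0.
  by move=> zr; apply/excess_eq0/(le_trans (ler_norm z))/(le_trans zr).
by rewrite !flat// subrr normr0 mulr0 mulr_ge0// ltW.
Qed.

Lemma le_sup_wedges i s : p i * excess (c i) s <= sup_wedges s.
Proof.
by have := le_sup_over wedge0 wedge_lip (s : R^o) (I : [set: nat] i).
Qed.

Lemma sup_wedges_le s M :
  (forall i, p i * excess (c i) s <= M) -> sup_wedges s <= M.
Proof. by move=> pM; apply: (sup_over_le N0) => i _; exact: pM. Qed.

Lemma sup_wedges_gt0 s : 0 < s -> 0 < sup_wedges s.
Proof.
move=> /c_small[i cs]; apply: lt_le_trans (le_sup_wedges i s).
by rewrite mulr_gt0// (lt_le_trans _ (le_excess _ _))// subr_gt0.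
Qed.

(** The supremum g is continuous because it is Lipschitz on bounded sets.  It is
    strictly increasing because s g(u) >= u g(s) for s <= u, which each wedge
    satisfies, while g is positive on positive arguments. *)
Lemma class_K_sup_wedges : class_K sup_wedges.
Proof.
have g0 : sup_wedges 0 = 0 by exact: (sup_over0 wedge0 wedge_lip).
split=> //.
- apply: continuous_subspaceT.
  exact: (lipschitz_balls_continuous (sup_over_lipschitz wedge0 wedge_lip N0)).
- move=> s u; rewrite !in_itv/= !andbT => s0 u0 su.
  have [s_gt0|s_le0] := ltP 0 s; last first.
    have -> : s = 0 by lra.
    by rewrite g0 sup_wedges_gt0//; lra.
  have gs0 := sup_wedges_gt0 s_gt0.
  have : sup_wedges s <= s / u * sup_wedges u.
    apply: sup_wedges_le => i.
    rewrite mulrAC ler_pdivlMr; last by lra.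
    apply: le_trans (ler_wpM2l s0 (le_sup_wedges i u)).
    by rewrite mulrCA -mulrA ler_pM2l// mulrC excess_star// s0 ltW.
  rewrite mulrAC ler_pdivlMr; nra.
- move=> s; rewrite in_itv/= andbT le_eqVlt => /predU1P[<-|s_gt0].
    by rewrite g0.
  exact/ltW/sup_wedges_gt0.
Qed.

End SupWedges.

Lemma nat_prefix_bound (R : realType) (p : nat -> R) (N : nat) :
  exists2 L : R, 0 < L & forall i, (i < N)%N -> p i <= L.
Proof.
elim: N => [|N [L L0 HL]]; first by exists 1.
exists (Num.max L (p N)); first by rewrite lt_max L0.
move=> i; rewrite ltnS leq_eqVlt le_max => /predU1P[->|/HL->//].
by rewrite lexx orbT.
Qed.

(** If K n is a Lipschitz constant on the ball of radius n + 1, the wedge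
    2 K_n (s - n/2)^+ is at least K_n s as soon as s >= n, hence bounds V on the
    shell n <= |x| < n + 1; and only finitely many wedges are nonzero at a given
    s. *)
Lemma lipschitz_balls_class_Kinfty (R : realType) (X : normedModType R)
    (V : X -> R) : V 0 = 0 -> lipschitz_on_bounded_balls V ->
  exists2 psi : R -> R, class_Kinfty psi & forall x, V x <= psi `|x|.
Proof.
move=> V0 lipV.
have /choice[K HK] : forall n : nat, exists K : R, 0 < K /\
    forall x : X, `|x| <= n.+1%:R -> V x <= K * `|x|.
  move=> n; have [K K0 HK] := lipV n.+1%:R (ltr0Sn _ _).
  exists K; split=> // x xn; have := HK x 0 xn.
  by rewrite normr0 V0 !subr0 => /(_ (ler0n _ _)); exact/le_trans/ler_norm.
pose p n := 2 * K n; pose c n : R := n%:R / 2.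
have p0 n : 0 < p n by rewrite mulr_gt0//; case: (HK n).
have c0 n : 0 <= c n by rewrite divr_ge0.
have cs s : 0 < s -> exists i, c i < s by exists 0%N; rewrite /c mul0r.
have pb r : exists2 L : R, 0 < L & forall i, c i < r -> p i <= L.
  have [L L0 HL] := nat_prefix_bound p (Num.truncn (r * 2)).+1.
  exists L => // i; rewrite /c ltr_pdivrMr// => ir; apply: HL.
  by rewrite -(ltr_nat R) (lt_trans ir)// truncnS_gt.
have wedge_le i s : p i * (s - c i) <= sup_wedges p c s.
  apply: le_trans (le_sup_wedges p0 c0 pb i s).
  by rewrite ler_pM2l// le_excess.
exists (sup_wedges p c).
  split; first exact: class_K_sup_wedges.
  move=> M; exists ((`|M| + 1) / p 0%N).
    by rewrite divr_ge0 ?addr_ge0// ltW.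
  apply: lt_le_trans (wedge_le 0%N _).
  rewrite /c mul0r subr0 mulrCA divff ?gt_eqF// mulr1.
  by rewrite (le_lt_trans (ler_norm _))// ltrDl.
move=> x; pose n := Num.truncn `|x|.
have /truncn_itv/andP[nx xn] := normr_ge0 x.
have [K0 /(_ x (ltW xn)) HKn] := HK n.
apply: le_trans HKn _; apply: le_trans (wedge_le n _).
by rewrite /p /c -mulrA mulrCA ler_pM2l//; rewrite -/n in nx; lra.
Qed.

(** * Flows *)

Section Flow.
Variables (R : realType) (X U : normedModType R) (S : fc_system X U).
Implicit Types (a e h r t : R) (x y z : X) (d : R -> U).

Lemma flow_cvg0 z d : dists S d -> flow S e z d @[e --> 0^'+] --> z.
Proof.
move=> Sd; have /continuous_within_itvcyP[_] := flow_continuous (x := z) Sd.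
by rewrite flow0.
Qed.

Lemma dini_derivative_le (V : X -> R) d x a :
  (\forall h \near (0 : R)^'+, V (flow S h x d) <= V x - h * a) ->
  (dini_derivative S V d x <= (- a)%:E)%E.
Proof.
move=> decr; rewrite /dini_derivative limf_einfE.
apply: ge_ereal_sup => _ [W nW <-].
have /filter_ex[h [[Wh Vh] h0]] : \forall h \near (0 : R)^'+,
    (W h /\ V (flow S h x d) <= V x - h * a) /\ 0 < h.
  by apply: filterI; [exact: filterI | exact: nbhs_right_gt].
apply: le_trans (ereal_inf_lbound _) _; first by exists h.
by rewrite lee_fin mulrC ler_pdivrMr//; lra.
Qed.

Hypothesis flow_lip : flow_lipschitz_on_compact_intervals S.

(** The flow does not see the value of the disturbance at time 0, although
    causality compares disturbances on the closed interval [0, t].  Start both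
    flows a little later, at time h: the disturbances agree from h up to t, the
    two states at time h are both close to z, and the Lipschitz constant is
    uniform in h and d. *)
Lemma flow_causal_pos t z d d' : 0 <= t -> dists S d -> dists S d' ->
  (forall s, 0 < s <= t -> d s = d' s) -> flow S t z d = flow S t z d'.
Proof.
rewrite le_eqVlt => /predU1P[<-|t0] Sd Sd' dd'; first by rewrite !flow0.
have z1 : 0 < `|z| + 1 by rewrite ltr_wpDl.
have [L L0 HL] := flow_lip t0 z1.
apply/eqP; rewrite -subr_eq0 -normr_le0; apply/ler_addgt0Pl => e e0.
rewrite addr0.
have m0 : 0 < Num.min 1 (e / (2 * L)).
  by rewrite lt_min ltr01 divr_gt0// mulr_gt0.
have close c : dists S c ->
    \forall h \near 0^'+, `|z - flow S h z c| < Num.min 1 (e / (2 * L)).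
  by move=> Sc; have /cvgrPdist_lt/(_ _ m0) := flow_cvg0 (z := z) Sc.
have near_h : \forall h \near (0 : R)^'+,
    ((`|z - flow S h z d| < Num.min 1 (e / (2 * L)) /\
      `|z - flow S h z d'| < Num.min 1 (e / (2 * L))) /\ 0 < h) /\ h < t.
  apply: filterI; last exact: nbhs_right_lt.
  apply: filterI; last exact: nbhs_right_gt.
  by apply: filterI; exact: close.
have [h [[[zd zd'] h0] ht]] := @filter_ex _ (0 : R)^'+ _ _ near_h.
have step c : dists S c ->
    flow S t z c = flow S (t - h) (flow S h z c) (time_shift h c).
  by move=> Sc; rewrite flow_cocycle// ?subrKC//; lra.
have th0 : 0 <= t - h by lra.
have -> : flow S t z d' = flow S (t - h) (flow S h z d') (time_shift h d).
  rewrite step//; apply: flow_causal => //;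
    [exact: dists_shift Sd' (ltW h0)|exact: dists_shift Sd (ltW h0)|].
  by move=> s /andP[s0 sth]; rewrite /time_shift dd'//; lra.
rewrite step//.
have inball y : `|z - y| < Num.min 1 (e / (2 * L)) -> `|y| <= `|z| + 1.
  rewrite lt_min => /andP[zy _].
  have := lerB_dist y z; rewrite distrC; lra.
apply: (le_trans (HL _ _ _ _ (inball _ zd) (inball _ zd') _ _)).
- by lra.
- exact: dists_shift Sd (ltW h0).
move: zd zd'; rewrite !lt_min => /andP[_ zd] /andP[_ zd'].
have := ler_distD z (flow S h z d) (flow S h z d').
rewrite (distrC _ z) => tri.
have : `|flow S h z d - flow S h z d'| <= e / L.
  have -> : e / L = e / (2 * L) + e / (2 * L) by field; rewrite gt_eqF.
  lra.
by rewrite ler_pdivlMr// mulrC.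
Qed.

(** The shift by h of the concatenation takes the value d h at time 0, where d'
    may differ; this is why causality on ]0, t] is needed. *)
Lemma flow_concat h t x d d' : 0 < h -> 0 <= t -> dists S d -> dists S d' ->
  flow S t (flow S h x d) d' = flow S (h + t) x (concat h d d').
Proof.
move=> h0 t0 Sd Sd'; have Sc := dists_concat Sd Sd' h0.
rewrite -flow_cocycle// ?ltW//.
have -> : flow S h x (concat h d d') = flow S h x d.
  apply: flow_causal => //; first exact: ltW.
  by move=> s /andP[_ sh]; rewrite /concat sh.
apply: flow_causal_pos => //; first exact: dists_shift Sc (ltW h0).
move=> s /andP[s0 _]; rewrite /time_shift /concat ifF ?addrK//.
by apply/negbTE; rewrite -ltNge ltrDr.
Qed.

Hypothesis ugas : UGAS S.

Lemma flow_at0 t d : 0 <= t -> dists S d -> flow S t 0 d = 0.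
Proof.
move=> t0 Sd; have [b [bK _] Hb] := ugas.
have [_ _ b0 _] := bK _ t0.
by apply/eqP; rewrite -normr_le0 -b0 -[X in b X _](normr0 X); exact: Hb.
Qed.

Lemma ugas_settling r e : 0 < r -> 0 < e -> exists2 T : R, 0 < T &
  forall x d t, `|x| <= r -> dists S d -> T <= t -> `|flow S t x d| <= e.
Proof.
move=> r0 e0; have [b [bK bL] Hb] := ugas.
have [_ _ /cvgrPdist_le/(_ _ e0) nearoo _] := bL _ r0.
have near_T : \forall T \near +oo, 0 < T /\ `|0 - b r T| <= e.
  by apply: filterI => //; apply: nbhs_pinfty_gt; exact: num_real.
have [T [T0 bT]] := @filter_ex _ (+oo : set_system R) _ _ near_T.
exists T => // x d t xr Sd Tt; have t0 : 0 <= t by lra.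
apply: le_trans (Hb x d t Sd t0) _.
have [_ bincr _ _] := bK _ t0; have [_ bdecr _ _] := bL _ r0.
apply: (@le_trans _ _ (b r t)).
  move: xr; rewrite le_eqVlt => /predU1P[->//|xr].
  by apply: ltW; apply: bincr; rewrite ?in_itv/= ?andbT ?(ltW r0).
apply: (@le_trans _ _ (b r T)).
  by apply: bdecr; rewrite ?in_itv/= ?andbT ?(ltW T0).
by move: bT; rewrite sub0r normrN; exact/le_trans/ler_norm.
Qed.

(** The rate 2 in the exponential, rather than 1, leaves room to bound
    e^(- 2h) by 1 - h for small h, so that the difference quotients themselves,
    and not only their limit, are at most -V(x) for small h. *)
Definition weighted_excess (k : nat) (t : R) (d : R -> U) (x : X) : R :=
  expR (2 * t) * excess k.+1%:R^-1 `|flow S t x d|.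

Lemma weighted_excess_ge0 k t d x : 0 <= weighted_excess k t d x.
Proof. by rewrite mulr_ge0 ?expR_ge0 ?excess_ge0. Qed.

Lemma weighted_excess_at0 k t d : 0 <= t -> dists S d ->
  weighted_excess k t d 0 = 0.
Proof.
by move=> t0 Sd; rewrite /weighted_excess flow_at0// normr0 excess_eq0 ?mulr0.
Qed.

(** After the settling time T of the ball of radius n + 1 into the ball of
    radius 1 / (n + 1), the terms with k <= n vanish; up to T, the flow has a
    Lipschitz constant common to all times and disturbances. *)
Lemma weighted_excess_lip (n : nat) : exists2 C : R, 0 < C &
  forall k t d x y, (k <= n)%N -> 0 <= t -> dists S d ->
    `|x| <= n.+1%:R -> `|y| <= n.+1%:R ->
    `|weighted_excess k t d x - weighted_excess k t d y| <= C * `|x - y|.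
Proof.
have n0 : 0 < n.+1%:R :> R by [].
have vn0 : 0 < n.+1%:R^-1 :> R by rewrite invr_gt0.
have [T T0 HT] := ugas_settling n0 vn0.
have [L L0 HL] := flow_lip T0 n0.
exists (expR (2 * T) * L); first by rewrite mulr_gt0 ?expR_gt0.
move=> k t d x y kn t0 Sd xn yn.
have vkn : n.+1%:R^-1 <= k.+1%:R^-1 :> R by rewrite lef_pV2 ?posrE// ler_nat.
rewrite /weighted_excess; have [tT|/ltW Tt] := leP t T; last first.
  rewrite !excess_eq0 ?(le_trans (HT _ _ _ _ _ Tt))//.
  by rewrite subrr normr0 !mulr_ge0 ?expR_ge0// ltW.
rewrite -mulrBr normrM ger0_norm ?expR_ge0// -mulrA.
rewrite ler_pM ?expR_ge0 ?ler_expR//; first by rewrite ler_pM2l.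
apply: le_trans (excess_lip _ _ _) _.
apply: le_trans (ler_dist_dist _ _) _.
by apply: HL => //; rewrite t0.
Qed.

End Flow.

(** * The converse theorem *)

Section Converse.
Variables (R : realType) (X U : normedModType R) (S : fc_system X U).
Hypothesis flow_lip : flow_lipschitz_on_compact_intervals S.
Hypothesis ugas : UGAS S.

(** An index (k, t, d) consists of the number k of the threshold 1 / (k + 1), a
    time t and a disturbance d. *)
Definition future : set (nat * R * (R -> U)) :=
  [set i | 0 <= i.1.2 /\ dists S i.2].

Definition lyap_term (a : nat -> R) (i : nat * R * (R -> U)) (x : X) : R :=
  a i.1.1 * weighted_excess S i.1.1 i.1.2 i.2 x.

Definition lyap (a : nat -> R) (x : X) : R := sup_over future (lyap_term a) x.

Lemma lyap_term0 a i : future i -> lyap_term a i 0 = 0.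
Proof.
by case: i => [[k t] d] [t0 Sd]; rewrite /lyap_term weighted_excess_at0// mulr0.
Qed.

(** A diagonal choice: a_k compensates the Lipschitz constant C_k of the terms
    of number k on the ball of radius k + 1, hence on all smaller balls.  On the
    ball of radius n + 1 this settles the terms with k > n; those with k <= n
    share the constant C_n. *)
Lemma exists_weights : exists2 a : nat -> R,
  forall k, 0 < a k <= 1 & unif_lipschitz future (lyap_term a).
Proof.
have /choice[C HC] : forall n, exists C : R, 0 < C /\
  forall k t d x y, (k <= n)%N -> 0 <= t -> dists S d ->
    `|x| <= n.+1%:R -> `|y| <= n.+1%:R ->
    `|weighted_excess S k t d x - weighted_excess S k t d y| <= C * `|x - y|.
  by move=> n; have [C C0 HC] := weighted_excess_lip flow_lip ugas n; exists C.
pose a n := (1 + C n)^-1.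
have C0 n : 0 < C n by case: (HC n).
have a0 n : 0 < a n by rewrite invr_gt0 addr_gt0.
have a1 n : a n <= 1 by rewrite invf_le1 ?lerDl ?ltW// addr_gt0.
have aC n : a n * C n <= 1.
  by rewrite mulrC ler_pdivrMr ?addr_gt0// mul1r lerDr.
exists a; first by move=> k; rewrite a0 a1.
move=> r r0; pose n := Num.truncn r.
have rn : r <= n.+1%:R by rewrite ltW// truncnS_gt.
exists (1 + C n); first by rewrite addr_gt0.
case=> [[k t] d] x y [/= t0 Sd] xr yr; rewrite /lyap_term/= -mulrBr normrM.
rewrite (gtr0_norm (a0 k)).
have [kn|/ltnW nk] := leqP k n.
  have [_ HCn] := HC n.
  apply: le_trans (_ : 1 * (C n * `|x - y|) <= _); last first.
    by rewrite mul1r ler_wpM2r// lerDr.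
  apply: ler_pM => //; first exact: ltW.
  by apply: HCn => //; exact: le_trans rn.
have [_ HCk] := HC k; have rk : r <= k.+1%:R.
  by rewrite (le_trans rn)// ler_nat.
apply: le_trans (_ : a k * (C k * `|x - y|) <= _).
  by rewrite ler_pM2l//; apply: HCk => //; exact: le_trans rk.
rewrite mulrA ler_wpM2r// (le_trans (aC k))// lerDl ltW//.
Qed.

Section Weights.
Variable a : nat -> R.
Hypothesis a_gt0 : forall k, 0 < a k.
Hypothesis lip : unif_lipschitz future (lyap_term a).

Lemma lyap_decay h x d : 0 < h -> dists S d ->
  expR (2 * h) * lyap a (flow S h x d) <= lyap a x.
Proof.
move=> h0 Sd; rewrite mulrC -ler_pdivlMr ?expR_gt0//.
apply: sup_over_le => [|[[k t] d'] [/= t0 Sd']]; first by exists (0%N, 0, d).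
rewrite ler_pdivlMr ?expR_gt0//.
have fut : future (k, h + t, concat h d d').
  by split=> /=; [rewrite addr_ge0 ?(ltW h0)|exact: dists_concat].
apply: le_trans (le_sup_over (@lyap_term0 a) lip x fut).
rewrite /lyap_term /weighted_excess/= (flow_concat flow_lip)//.
rewrite [2 * (h + t)]mulrDr expRD; lra.
Qed.

Lemma lyap_ge0 d x : dists S d -> 0 <= lyap a x.
Proof.
move=> Sd; have fut : future (0%N, 0, d) by [].
apply: le_trans (le_sup_over (@lyap_term0 a) lip x fut).
by rewrite mulr_ge0 ?weighted_excess_ge0// ltW.
Qed.

Lemma dini_derivative_lyap x d : dists S d ->
  (dini_derivative S (lyap a) d x <= (- lyap a x)%:E)%E.
Proof.
move=> Sd; apply: dini_derivative_le.
have near_h : \forall h \near (0 : R)^'+, h < 1 / 2 /\ 0 < h.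
  by apply: filterI; [apply: nbhs_right_lt | exact: nbhs_right_gt].
move: near_h; apply: filterS => h [h12 h0].
have := lyap_decay x h0 Sd; have := expR_ge1Dx (2 * h).
have := lyap_ge0 (flow S h x d) Sd.
set v := lyap a x; set w := lyap a _; set E := expR _ => w0 E1 Ew.
have vw : (1 - h) * ((1 + 2 * h) * w) <= (1 - h) * v.
  apply: ler_wpM2l; first lra.
  by apply: le_trans Ew; apply: ler_wpM2r.
(* (1 - h)(1 + 2h) = 1 + h (1 - 2h) >= 1 *)
have hw : 0 <= h * ((1 - 2 * h) * w) by rewrite !mulr_ge0//; lra.
lra.
Qed.

End Weights.

(** An admissible disturbance is needed for V to dominate alpha: without one,
    the supremum ranges over the empty set. *)
Lemma converse_lyapunov d0 : dists S d0 ->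
  exists V : X -> R, noncoercive_lyapunov S V /\ lipschitz_on_bounded_balls V.
Proof.
move=> Sd0; have [a a01 lip] := exists_weights.
have a0 k : 0 < a k by case/andP: (a01 k).
have fut0 : future !=set0 by exists (0%N, 0, d0).
have lipV := sup_over_lipschitz (@lyap_term0 a) lip fut0.
have V0 := sup_over0 (@lyap_term0 a) lip fut0.
exists (lyap a); split=> //.
pose alpha := sup_wedges a (fun k => k.+1%:R^-1).
have alphaV x : alpha `|x| <= lyap a x.
  apply: sup_wedges_le => k.
  have : future (k, 0, d0) by [].
  move=> /(le_sup_over (@lyap_term0 a) lip x); apply: le_trans.
  by rewrite /lyap_term /weighted_excess/= mulr0 expR0 mul1r flow0.
have v0 k : 0 <= k.+1%:R^-1 :> R by rewrite invr_ge0.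
have vs s : 0 < s -> exists k, k.+1%:R^-1 < s :> R.
  move=> s0; exists (Num.truncn s^-1).
  by rewrite invf_plt ?posrE// truncnS_gt.
have pb (r : R) : exists2 L : R, 0 < L & forall k, k.+1%:R^-1 < r -> a k <= L.
  by exists 1 => // k _; case/andP: (a01 k).
have alphaK : class_K alpha := class_K_sup_wedges a0 v0 vs pb.
have Vpos x : x != 0 -> 0 < lyap a x.
  move=> x0; apply: lt_le_trans (alphaV x).
  by apply: sup_wedges_gt0; rewrite ?normr_gt0.
split=> //; first exact: lipschitz_balls_continuous.
  by move=> x; exact: lyap_ge0 Sd0.
have [psi psiK Vpsi] := lipschitz_balls_class_Kinfty V0 lipV.
exists psi, alpha; split=> //.
  by move=> x x0; rewrite Vpos//=; exact: Vpsi.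
move=> x d Sd; apply: le_trans (dini_derivative_lyap a0 lip x Sd) _.
by rewrite lee_fin lerN2.
Qed.

End Converse.

Theorem theorem5p6 (R : realType) (X U : normedModType R) (S : fc_system X U) :
  flow_lipschitz_on_compact_intervals S ->
  UGAS S ->
  exists V : X -> R, noncoercive_lyapunov S V /\ lipschitz_on_bounded_balls V.
Proof.
move=> flow_lip ugas.
have [[d0 Sd0]|noD] := pselect (exists d, dists S d).
  exact: converse_lyapunov Sd0.
(* Without disturbances the decay condition is void, and the norm will do. *)
have lip : lipschitz_on_bounded_balls (fun x : X => `|x|).
  by move=> r _; exists 1 => // x y _ _; rewrite mul1r ler_dist_dist.
have idK : class_K (fun r : R => r).
  split=> //; first by apply: continuous_subspaceT => x; exact: cvg_id.
  by move=> x; rewrite in_itv/= andbT.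
exists (fun x => `|x|); split=> //; split=> //.
- exact: lipschitz_balls_continuous.
- exact: normr0.
exists id, id; split=> //.
- split=> // M; exists (`|M| + 1); first by rewrite addr_ge0.
  by rewrite (le_lt_trans (ler_norm _))// ltrDl.
- by move=> x x0; rewrite normr_gt0 x0/=.
- by move=> x d Sd; case: noD; exists d.
Qed.
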